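(* Let $\mu\in\mathcal{D}_{\mathrm{alg}}(1,* )$ be an $\eta$-diagonal $*$-distribution. Then $ZZ^*$ and $Z^*Z$ are Boolean independent in the noncommutative probability space $(\mathbb{C}\langle Z,Z^*\rangle,\mu)$.
   Context: $\mathbb{C}\langle Z,Z^*\rangle$ is the algebra of complex polynomials in two non-commuting variables $Z,Z^*$; $\mathcal{D}_{\mathrm{alg}}(1,* )$ is the set of linear functionals $\mu$ on it with $\mu(1)=1$. $\mathcal{W}^+=\bigsqcup_{n\ge1}\{1,*\}^n$ is the set of non-empty words over $\{1,*\}$, and for $w=(\ell_1,\dots,\ell_n)$ one sets $Z^w=Z^{\ell_1}\cdots Z^{\ell_n}$, $z^w=z^{\ell_1}\cdots z^{\ell_n}$ (non-commuting formal indeterminates $z,z^*$). The moment series of $\mu$ is $M_\mu=\sum_{w\in\mathcal{W}^+}\mu(Z^w)z^w$ and its $\eta$-series is $\eta_\mu=M_\mu(1+M_\mu)^{-1}$. $\mu$ is $\eta$-diagonal if the coefficient of $z^w$ in $\eta_\mu$ is $0$ for every $w$ that is not of the form $(1,* )^m$ or $( *,1)^m$ with $m\ge1$ (powers with respect to concatenation). A noncommutative probability space $(\mathcal{A},\varphi)$ is a unital complex algebra $\mathcal{A}$ with a linear functional $\varphi$ such that $\varphi(1)=1$. Elements $a_1,a_2\in\mathcal{A}$ are Boolean independent if for all positive integers $n,p_1,\dots,p_n$ and all indices $i_1,\dots,i_n\in\{1,2\}$ with $i_k\neq i_{k+1}$ for $k=1,\dots,n-1$, one has $\varphi(a_{i_1}^{p_1}\cdots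 a_{i_n}^{p_n})=\varphi(a_{i_1}^{p_1})\cdots\varphi(a_{i_n}^{p_n})$. *)

(* Defs.v *)
From HB Require Import structures.
From mathcomp Require Import all_boot all_order all_algebra.
From mathcomp Require Import boolp functions reals.
From mathcomp Require Import complex.
From mathcomp.multinomials Require Import monalg.

Set Implicit Arguments.
Unset Strict Implicit.
Unset Printing Implicit Defensive.

Import GRing.Theory.

Local Open Scope ring_scope.

(* Words over {1,*} are sequences of letters. *)
Inductive letter := One | Star.

Definition bool_of_letter (l : letter) : bool := if l is Star then true else false.
Definition letter_of_bool (b : bool) : letter := if b then Star else One.

Lemma bool_of_letterK : cancel bool_of_letter letter_of_bool.
Proof. by case. Qed.

HB.instance Definition _ := Countable.copy letter (can_type bool_of_letterK).

(* C<Z,Z*>: the monoid algebra of the free monoid of words over {1,*}. *)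
Definition starPoly (C : comNzRingType) : Type := {malg C[{fmonom letter}]}.

HB.instance Definition _ (C : comNzRingType) :=
  GRing.Lalgebra.copy (starPoly C) {malg C[{fmonom letter}]}.

(* monalg makes a monoid algebra an algType only when the monoid is
   commutative. *)
Fact starPoly_scalerAr (C : comNzRingType) (c : C) (f g : starPoly C) :
  c *: (f * g) = f * (c *: g).
Proof.
have comm_c : c%:MP * f = f * c%:MP :> {malg C[{fmonom letter}]}.
  rewrite !malgM_def fgmulUg fgmulgU; apply: eq_bigr => k _.
  by rewrite mulrC mul1m mulm1.
have e := @mul_malgC {fmonom letter} C c.
by rewrite -[LHS]e -[in RHS](e g) mulrA comm_c mulrA.
Qed.

HB.instance Definition _ (C : comNzRingType) :=
  GRing.Lalgebra_isAlgebra.Build C (starPoly C) (@starPoly_scalerAr C).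

Definition gen (C : comNzRingType) (l : letter) : starPoly C := << fmu l >>.

Definition genZ (C : comNzRingType) : starPoly C := gen C One.
Definition genZs (C : comNzRingType) : starPoly C := gen C Star.

Definition monomZ (C : comNzRingType) (w : seq letter) : starPoly C :=
  \prod_(l <- w) gen C l.

(* The functional of a noncommutative probability space on the unital algebra
   A. *)
Record expectation (C : comNzRingType) (A : algType C) := Expectation {
  expectation_fun :> {scalar A};
  expectation1 : expectation_fun 1 = 1
}.

Definition Dalg (C : comNzRingType) := expectation (starPoly C).

(* The indices 1 and 2 are encoded by false and true, positions 1..n by 0..n-1;
   the product is taken from left to right. *)
Definition boolean_independent (C : comNzRingType) (A : algType C)
    (phi : expectation A) (a1 a2 : A) : Prop :=
  let a (b : bool) := if b then a2 else a1 in
  forall (n : nat) (p : nat -> nat) (i : nat -> bool),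
    (0 < n)%N ->
    (forall k, (k < n)%N -> (0 < p k)%N) ->
    (forall k, (k.+1 < n)%N -> i k != i k.+1) ->
    phi (\prod_(k < n) a (i k) ^+ p k) = \prod_(k < n) phi (a (i k) ^+ p k).

(* Formal power series in noncommuting indeterminates indexed by I: f w is the
   coefficient of the word w. *)
Definition ncseries (I : Type) (R : nzRingType) : Type := seq I -> R.

HB.instance Definition _ (I : Type) (R : nzRingType) :=
  GRing.Zmodule.copy (ncseries I R) (seq I -> R).

Section NCSeries.
Variables (I : Type) (R : nzRingType).
Implicit Types (f g h : ncseries I R) (x : I) (w : seq I).

Definition ncone : ncseries I R := fun w => if w is [::] then 1 else 0.

Definition ncmul f g : ncseries I R :=
  fun w => \sum_(i < (size w).+1) f (take i w) * g (drop i w).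

Let shift x f : ncseries I R := fun w => f (x :: w).

Lemma ncseriesP f g : (forall w, f w = g w) -> f = g.
Proof. by move=> fg; apply/funext. Qed.

Lemma ncaddE f g w : (f + g) w = f w + g w. Proof. by []. Qed.

Lemma ncmul_nil f g : ncmul f g [::] = f [::] * g [::].
Proof. by rewrite /ncmul big_ord1. Qed.

Lemma ncmul_cons f g x w :
  ncmul f g (x :: w) = f [::] * g (x :: w) + ncmul (shift x f) g w.
Proof. by rewrite /ncmul /= big_ord_recl. Qed.

Lemma ncmulDl : left_distributive ncmul +%R.
Proof.
move=> f g h; apply: ncseriesP => w; rewrite ncaddE /ncmul -big_split /=.
by apply: eq_bigr => i _; rewrite ncaddE mulrDl.
Qed.

Lemma ncmulDr : right_distributive ncmul +%R.
Proof.
move=> f g h; apply: ncseriesP => w; rewrite ncaddE /ncmul -big_split /=.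
by apply: eq_bigr => i _; rewrite ncaddE mulrDr.
Qed.

Lemma ncmul1l : left_id ncone ncmul.
Proof.
move=> f; apply: ncseriesP => -[|x w]; first by rewrite ncmul_nil mul1r.
rewrite ncmul_cons mul1r /ncmul big1 ?addr0 // => i _.
by rewrite /shift mul0r.
Qed.

Lemma ncmul1r : right_id ncone ncmul.
Proof.
move=> f; apply: ncseriesP => w; elim: w f => [|x w IHw] f.
  by rewrite ncmul_nil mulr1.
by rewrite ncmul_cons mulr0 add0r IHw.
Qed.

Lemma ncmulA : associative ncmul.
Proof.
move=> f g h; apply: ncseriesP => w; elim: w f g h => [|x w IHw] f g h.
  by rewrite !ncmul_nil mulrA.
rewrite !ncmul_cons ncmul_nil mulrDr mulrA -addrA IHw; congr (_ + _).
have -> : shift x (ncmul f g) =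
    (fun w => f [::] * shift x g w) + ncmul (shift x f) g :> ncseries I R.
  by apply: ncseriesP => v; rewrite /shift ncmul_cons.
rewrite ncmulDl ncaddE; congr (_ + _).
by rewrite /ncmul mulr_sumr; apply: eq_bigr => i _; rewrite mulrA.
Qed.

Lemma ncone_neq0 : ncone != 0.
Proof.
by apply/eqP => /(congr1 (fun f => f [::])) /eqP; rewrite oner_eq0.
Qed.

HB.instance Definition _ := GRing.Zmodule_isNzRing.Build (ncseries I R)
  ncmulA ncmul1l ncmul1r ncmulDl ncmulDr ncone_neq0.

(* Units are the series with a two-sided inverse; as for every unitRingType,
   f^-1 is that inverse if f is a unit, and f otherwise. *)
Definition ncinvertible f : Prop := exists g, g * f = 1 /\ f * g = 1.

Definition ncunit : {pred ncseries I R} := fun f => `[< ncinvertible f >].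

Definition ncinv f : ncseries I R :=
  if pselect (ncinvertible f) is left e then projT1 (cid e) else f.

Fact ncmulVr : {in ncunit, left_inverse 1 ncinv *%R}.
Proof.
move=> f /asboolP uf; rewrite /ncinv; case: pselect => // e.
by case: cid => g [].
Qed.

Fact ncmulrV : {in ncunit, right_inverse 1 ncinv *%R}.
Proof.
move=> f /asboolP uf; rewrite /ncinv; case: pselect => // e.
by case: cid => g [].
Qed.

Fact ncunitP f g : g * f = 1 /\ f * g = 1 -> f \in ncunit.
Proof. by move=> e; apply/asboolP; exists g. Qed.

Fact ncinv_out : {in [predC ncunit], ncinv =1 id}.
Proof.
by move=> f /asboolP uf; rewrite /ncinv; case: pselect.
Qed.

HB.instance Definition _ := GRing.NzRing_hasMulInverse.Build (ncseries I R)
  ncmulVr ncmulrV ncunitP ncinv_out.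

Let rinv_rec f : nat -> seq I -> R := fix rec n w :=
  match n, w with
  | n'.+1, x :: w' =>
      - \sum_(i < (size w').+1) shift x f (take i w') * rec n' (drop i w')
  | _, _ => 1
  end.

Let rinv_recE f n w : (size w <= n)%N -> rinv_rec f n w = rinv_rec f (size w) w.
Proof.
elim: n {-2}n (leqnn n) w => [|N IHN] [|n] // nN [|x w] //= wn.
congr (- _); apply: eq_bigr => i _; congr (_ * _).
have dw : (size (drop i w) <= size w)%N by rewrite size_drop leq_subr.
rewrite (IHN n nN _ (leq_trans dw wn)).
by rewrite (IHN (size w) (leq_trans wn nN) _ dw).
Qed.

Let ncrinv f : f [::] = 1 -> exists2 g : ncseries I R, g [::] = 1 & f * g = 1.
Proof.
move=> f0; exists (fun w => rinv_rec f (size w) w) => //.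
apply: ncseriesP => -[|x w]; rewrite /GRing.mul /=.
  by rewrite ncmul_nil f0 mulr1.
rewrite ncmul_cons f0 mul1r /= addrC; apply/eqP; rewrite subr_eq0; apply/eqP.
apply: eq_bigr => i _; congr (_ * _).
by rewrite rinv_recE // size_drop leq_subr.
Qed.

Lemma ncunit_coef1 f : f [::] = 1 -> f \is a GRing.unit.
Proof.
move=> /ncrinv [g /ncrinv [h _ gh1] fg1].
have fh : f = h by rewrite -[f]mulr1 -gh1 mulrA fg1 mul1r.
by apply/asboolP; exists g; rewrite {1}fh.
Qed.

End NCSeries.

Definition moment_series (C : comNzRingType) (mu : Dalg C) : ncseries letter C :=
  fun w => if w is [::] then 0 else mu (monomZ C w).

Definition eta_series (C : comNzRingType) (mu : Dalg C) : ncseries letter C :=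
  moment_series mu / (1 + moment_series mu).

(* The division in eta_series is by a unit. *)
Lemma moment_series_unit (C : comNzRingType) (mu : Dalg C) :
  1 + moment_series mu \is a GRing.unit.
Proof. by apply: ncunit_coef1; rewrite ncaddE addr0. Qed.

Definition wpow (w : seq letter) (m : nat) : seq letter := flatten (nseq m w).

Definition alternating (w : seq letter) : Prop :=
  exists2 m : nat, (0 < m)%N &
    w = wpow [:: One; Star] m \/ w = wpow [:: Star; One] m.

Definition eta_diagonal (C : comNzRingType) (mu : Dalg C) : Prop :=
  forall w : seq letter, w != [::] -> ~ alternating w -> eta_series mu w = 0.

(* Main.v *)
(** Put [F w = mu (Z^w)].  The identity [eta * (1 + M) = M] says that, for
    nonempty [w], [F w] is the sum of [eta w1 * F w2] over the factorizations
    [w = w1 w2] with [w1] nonempty.  If [mu] is eta-diagonal, [eta] vanishes on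
    every word with two equal adjacent letters, so in
    [w = (u x)(x v)] no [w1] reaches beyond [u x] and, by induction on the
    length of [u], [F ((u x)(x v)) = F (u x) * F (x v)].  The boundary between a
    power of [Z Z*] and a power of [Z* Z] is such a repetition, hence [F]
    factors at every boundary of an alternating product. *)
Require Import Defs.
From HB Require Import structures.
From mathcomp Require Import all_boot all_order all_algebra.
From mathcomp Require Import boolp functions reals.
From mathcomp Require Import complex.
From mathcomp.multinomials Require Import monalg.

Set Implicit Arguments.
Unset Strict Implicit.
Unset Printing Implicit Defensive.

Import GRing.Theory.

Local Open Scope ring_scope.

(** Starting at [b], the last letter of the repeated word, makes the induction close: every copy is
    entered from a [b]. *)
Lemma path_wpow (a b : letter) m :
  a != b -> path (fun x y => x != y) b (wpow [:: a; b] m).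
Proof. by move=> ab; elim: m => //= m ->; rewrite eq_sym ab. Qed.

Lemma alternating_sorted w : alternating w -> sorted (fun x y => x != y) w.
Proof.
by case=> m _ [] ->; [apply: (path_sorted (x := Star)) |
  apply: (path_sorted (x := One))]; apply: path_wpow.
Qed.

Lemma not_alternating_repeat u x v : ~ alternating (u ++ x :: x :: v).
Proof.
by move=> /alternating_sorted/cat_sorted2[_] /=; rewrite eqxx.
Qed.

Section Moments.
Variables (C : comNzRingType) (mu : Dalg C).

Lemma monomZ_cat u v : monomZ C (u ++ v) = monomZ C u * monomZ C v.
Proof. by rewrite /monomZ big_cat. Qed.

Lemma monomZ_wpow w m : monomZ C (wpow w m) = monomZ C w ^+ m.
Proof.
elim: m => [|m IHm]; first by rewrite /monomZ big_nil expr0.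
by rewrite exprS -IHm -monomZ_cat.
Qed.

Lemma moment1E w : (1 + moment_series mu) w = mu (monomZ C w).
Proof.
case: w => [|x w]; rewrite ncaddE /=; last by rewrite add0r.
by rewrite addr0 /monomZ big_nil expectation1.
Qed.

Lemma eta_mul_moment1 :
  eta_series mu * (1 + moment_series mu) = moment_series mu.
Proof. by rewrite divrK // moment_series_unit. Qed.

Lemma eta_series_nil : eta_series mu [::] = 0.
Proof.
have := congr1 (fun f => f [::]) eta_mul_moment1.
by rewrite /GRing.mul /= ncmul_nil moment1E /monomZ big_nil expectation1 mulr1.
Qed.

Lemma moment_rec w : w != [::] ->
  mu (monomZ C w) =
    \sum_(i < size w) eta_series mu (take i.+1 w) * mu (monomZ C (drop i.+1 w)).
Proof.
case: w => // x w _.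
have := congr1 (fun f => f (x :: w)) eta_mul_moment1.
rewrite {1}/GRing.mul /= => <-.
(* The empty prefix contributes nothing, as [eta] has no constant term; hence the shift to
   [i.+1]. *)
rewrite /ncmul big_ord_recl /= eta_series_nil mul0r add0r.
by apply: eq_bigr => i _; rewrite moment1E.
Qed.

Hypothesis eta_repeat : forall u x v, eta_series mu (u ++ x :: x :: v) = 0.

Lemma moment_cat_repeat u x v :
  mu (monomZ C (rcons u x ++ x :: v)) =
    mu (monomZ C (rcons u x)) * mu (monomZ C (x :: v)).
Proof.
have [n] := ubnP (size u); elim: n u => // n IHn u; rewrite ltnS => un.
rewrite moment_rec; last by case: (u).
rewrite [in RHS]moment_rec; last by case: (u).
(* Separate the prefixes inside [rcons u x] from the longer ones; the latter contain [x :: x], so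
   [eta] kills them. *)
rewrite size_cat big_split_ord /= [X in _ + X]big1 ?addr0 => [|i _].
  rewrite mulr_suml; apply: eq_bigr => -[i /= lti] _.
  rewrite takel_cat // -mulrA; congr (_ * _).
  (* If the prefix is all of [rcons u x], what is left of it has moment 1. Otherwise what is left
     still ends in [x] and the induction hypothesis splits the tail. *)
  move: lti; rewrite size_rcons ltnS leq_eqVlt => /orP[/eqP iu|iu].
    have si : size (rcons u x) = i.+1 by rewrite size_rcons iu.
    by rewrite -si drop_size_cat // drop_size {2}/monomZ big_nil
      expectation1 mul1r.
  rewrite drop_cat size_rcons ltnS iu drop_rcons //.
  by apply: IHn; rewrite size_drop (leq_trans _ un) // -subSn // leq_subLR
    addSn ltnS leq_addl.
rewrite -addnS take_cat ltnNge leq_addr /= addKn /=.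
by rewrite cat_rcons eta_repeat mul0r.
Qed.

End Moments.

(** Each block ends with the letter that begins the other one, so every change of index creates a
    repeated letter. *)
Definition block (b : bool) : seq letter :=
  [:: letter_of_bool b; letter_of_bool (~~ b)].

Lemma wpow_block_rcons b m : (0 < m)%N ->
  exists u, wpow (block b) m = rcons u (letter_of_bool (~~ b)).
Proof.
case: m => // m _; elim: m => [|m [u IHm]].
  by exists [:: letter_of_bool b].
by exists (block b ++ u); rewrite rcons_cat -IHm.
Qed.

Lemma wpow_block_cons b m : (0 < m)%N ->
  exists v, wpow (block b) m = letter_of_bool b :: v.
Proof. by case: m => // m _; eexists. Qed.

Lemma monomZ_block (C : comNzRingType) b :
  monomZ C (block b) = if b then genZs C * genZ C else genZ C * genZs C.
Proof. by rewrite /monomZ !big_cons big_nil mulr1; case: b. Qed.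

Lemma eta_diagonal_boolean_independent (C : comNzRingType) (mu : Dalg C) :
  eta_diagonal mu ->
  boolean_independent mu (genZ C * genZs C) (genZs C * genZ C).
Proof.
move=> eta_mu a [//|n] p i _ p_gt0 i_alt.
have eta_repeat u x v : eta_series mu (u ++ x :: x :: v) = 0.
  by apply: eta_mu; [case: u | apply: not_alternating_repeat].
have aE k : a (i k) ^+ p k = monomZ C (wpow (block (i k)) (p k)).
  by rewrite monomZ_wpow monomZ_block.
(* The claim is strengthened: the induction also records that the product is a single word and which
   letter ends it, so that [moment_cat_repeat] applies at the next boundary. *)
suff [u _ ->] : exists2 u,
    \prod_(k < n.+1) a (i k) ^+ p k =
      monomZ C (rcons u (letter_of_bool (~~ i n))) &
    mu (\prod_(k < n.+1) a (i k) ^+ p k) =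
      \prod_(k < n.+1) mu (a (i k) ^+ p k) by [].
elim: n p_gt0 i_alt => [|n IHn] p_gt0 i_alt.
  have [u uE] := wpow_block_rcons (i 0) (p_gt0 0 isT).
  by exists u; rewrite !big_ord1 // aE uE.
have [||u prodE mu_prod] := IHn.
- by move=> k kn; apply: p_gt0; apply: ltnW.
- by move=> k kn; apply: i_alt; apply: ltnW.
have [u' u'E] := wpow_block_rcons (i n.+1) (p_gt0 n.+1 (ltnSn _)).
have [v vE] := wpow_block_cons (i n.+1) (p_gt0 n.+1 (ltnSn _)).
have iN : i n.+1 = ~~ i n.
  by move: (i_alt n (ltnSn _)); case: (i n) (i n.+1) => [] [].
exists (rcons u (letter_of_bool (~~ i n)) ++ u').
  by rewrite big_ord_recr /= prodE aE u'E -monomZ_cat rcons_cat.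
rewrite big_ord_recr [RHS]big_ord_recr /= -mu_prod prodE aE vE iN -monomZ_cat.
exact: moment_cat_repeat.
Qed.

Theorem mainTheorem2 (R : realType) (mu : Dalg R[i]) :
  eta_diagonal mu ->
  boolean_independent mu (genZ R[i] * genZs R[i]) (genZs R[i] * genZ R[i]).
Proof. exact: eta_diagonal_boolean_independent. Qed.
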